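(* Let $m\ge1$ and, for $i=1,\dots,m$, let $n_i\ge1$ be an integer, $\alpha_i\in(1,2)$, $d_i>0$ and $a_i<b_i$. Let $$\mathbf{A}=\sum_{i=1}^{m}I_{n_i^-}\otimes A_{n_i}\otimes I_{n_i^+},\qquad \mathbf{P}=\sum_{i=1}^{m}I_{n_i^-}\otimes\tau(A_{n_i})\otimes I_{n_i^+}.$$ Then the spectrum of the preconditioned matrix $\mathbf{P}^{-1}\mathbf{A}$ is uniformly bounded below by $1/2$ and above by $3/2$: every eigenvalue $\lambda$ of $\mathbf{P}^{-1}\mathbf{A}$ lies in the open interval $(1/2,3/2)$, for all choices of the sizes $n_1,\dots,n_m$.
   Context: $\mathbf{A}$ is the coefficient matrix of the shifted Grünwald–Letnikov finite difference discretization of $-\sum_{i=1}^m d_i\,\partial^{\alpha_i}u/\partial|x_i|^{\alpha_i}=y$ (Riesz fractional derivatives) on $\prod_{i=1}^m[a_i,b_i]$ with zero boundary condition, and is given explicitly as follows. For $\alpha\in(1,2)$ set $g_0^{(\alpha)}=1$ and $g_k^{(\alpha)}=\left(1-\frac{\alpha+1}{k}\right)g_{k-1}^{(\alpha)}$ for $k\ge1$. $G_n^{(\alpha)}$ is the $n\times n$ symmetric Toeplitz matrix with first column $[t_0,\dots,t_{n-1}]^{\intercal}$, where $t_0=-2g_1^{(\alpha)}$, $t_1=-(g_0^{(\alpha)}+g_2^{(\alpha)})$, and $t_k=-g_{k+1}^{(\alpha)}$ for $2\le k\le n-1$. For a symmetric Toeplitz matrix $T_n$ with first column $[t_0,\dots,t_{n-1}]^{\intercal}$,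 $\tau(T_n)=T_n-H_n$, where $H_n$ is the $n\times n$ Hankel matrix (constant along antidiagonals) whose antidiagonals are successively $t_2,t_3,\dots,t_{n-1},0,0,0,t_{n-1},\dots,t_3,t_2$; i.e. its $(i,j)$ entry ($1\le i,j\le n$) is $t_{i+j}$ if $i+j\le n-1$, $0$ if $i+j\in\{n,n+1,n+2\}$, and $t_{2n+2-(i+j)}$ if $i+j\ge n+3$. Put $A_{n_i}=w_iG_{n_i}^{(\alpha_i)}$ with $w_i=\frac{d_i\,c(\alpha_i)}{h_i^{\alpha_i}}>0$, $c(\alpha_i)=\frac{-1}{2\cos(\alpha_i\pi/2)}>0$, $h_i=\frac{b_i-a_i}{n_i+1}$. $I_k$ is the $k\times k$ identity, $\otimes$ is the Kronecker product, $n_i^-=\prod_{j=1}^{i-1}n_j$, $n_i^+=\prod_{j=i+1}^{m}n_j$, with $n_1^-=n_m^+=1$. The matrix $\mathbf{P}$ is symmetric positive definite, hence invertible. *)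

(* Defs.v *)
From HB Require Import structures.
From mathcomp Require Import all_boot all_order all_algebra.
From mathcomp Require Import all_classical all_reals all_analysis.
From mathcomp Require Import mxtens complex.

Set Implicit Arguments.
Unset Strict Implicit.
Unset Printing Implicit Defensive.

Import Order.TTheory GRing.Theory Num.Theory.
Local Open Scope ring_scope.

Definition toeplitz (R : Type) (n : nat) (t : nat -> R) : 'M[R]_n :=
  \matrix_(i < n, j < n) t `|i - j|%N.

(* Entry in (0-based) row k of the first column of T, and 0 if k >= n. *)
Definition first_col (R : nzRingType) (n : nat) (T : 'M[R]_n) (k : nat) : R :=
  match (insub k : option 'I_n), (insub 0%N : option 'I_n) with
  | Some i, Some j => T i j
  | _, _ => 0
  end.

(* Here [s] is the sum of the 1-based row and column indices. *)
Definition hankel_part (R : nzRingType) (n : nat) (t : nat -> R) : 'M[R]_n :=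
  \matrix_(i < n, j < n)
    let s := (i.+1 + j.+1)%N in
    if (s < n)%N then t s
    else if (s <= n + 2)%N then 0
    else t (2 * n + 2 - s)%N.

(* Meaningful only when T is a symmetric Toeplitz matrix. *)
Definition tau (R : nzRingType) (n : nat) (T : 'M[R]_n) : 'M[R]_n :=
  T - hankel_part n (first_col T).

Fixpoint gl_coef (R : fieldType) (alpha : R) (k : nat) : R :=
  match k with
  | 0 => 1
  | k'.+1 => (1 - (alpha + 1) / k'.+1%:R) * gl_coef alpha k'
  end.

Definition gl_symbol (R : fieldType) (alpha : R) (k : nat) : R :=
  match k with
  | 0 => - (2 * gl_coef alpha 1)
  | 1 => - (gl_coef alpha 0 + gl_coef alpha 2)
  | k'.+2 => - gl_coef alpha k'.+3
  end.

Definition gl_mx (R : fieldType) (n : nat) (alpha : R) : 'M[R]_n :=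
  toeplitz n (gl_symbol alpha).

Definition riesz_const (R : realType) (alpha : R) : R :=
  -1 / (2 * cos (alpha * pi / 2)).

Definition mesh_size (R : realType) (n : nat) (a b : R) : R :=
  (b - a) / n.+1%:R.

Definition riesz_weight (R : realType) (n : nat) (alpha d a b : R) : R :=
  d * riesz_const alpha / (mesh_size n a b `^ alpha).

Definition riesz_mx (R : realType) (n : nat) (alpha d a b : R) : 'M[R]_n :=
  riesz_weight n alpha d a b *: gl_mx n alpha.

Definition prod_before (m : nat) (n : 'I_m -> nat) (i : 'I_m) : nat :=
  (\prod_(j < m | (j < i)%N) n j)%N.

Definition prod_after (m : nat) (n : 'I_m -> nat) (i : 'I_m) : nat :=
  (\prod_(j < m | (i < j)%N) n j)%N.

Lemma prod_splitE (m : nat) (n : 'I_m -> nat) (i : 'I_m) :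
  (prod_before n i * n i * prod_after n i = \prod_(j < m) n j)%N.
Proof.
rewrite /prod_before /prod_after [RHS](bigID (fun j : 'I_m => (j < i)%N)) /= -mulnA.
congr (_ * _)%N.
rewrite [RHS](bigD1 i) /=; last by rewrite ltnn.
by congr (_ * _)%N; apply: eq_bigl => j; rewrite -leqNgt andbC ltn_neqAle eq_sym.
Qed.

(* The cast identifies the dimension n_i^- * n_i * n_i^+ with n_1 * ... * n_m. *)
Definition kron_sum (R : nzRingType) (m : nat) (n : 'I_m -> nat)
    (B : forall i : 'I_m, 'M[R]_(n i)) : 'M[R]_(\prod_(j < m) n j)%N :=
  \sum_(i < m)
    castmx (prod_splitE n i, prod_splitE n i)
      (tensmx (tensmx (1%:M : 'M[R]_(prod_before n i)) (B i))
              (1%:M : 'M[R]_(prod_after n i))).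

Definition coef_mx (R : realType) (m : nat) (n : 'I_m -> nat)
    (alpha d a b : 'I_m -> R) : 'M[R]_(\prod_(j < m) n j)%N :=
  kron_sum (fun i => riesz_mx (n i) (alpha i) (d i) (a i) (b i)).

Definition precond_mx (R : realType) (m : nat) (n : 'I_m -> nat)
    (alpha d a b : 'I_m -> R) : 'M[R]_(\prod_(j < m) n j)%N :=
  kron_sum (fun i => tau (riesz_mx (n i) (alpha i) (d i) (a i) (b i))).

(* [eigenvalue] only sees eigenvalues in the base field, so the spectrum of a
   real matrix is taken over R[i]. *)
Definition in_spectrum (R : realType) (N : nat) (M : 'M[R]_N)
    (lambda : R[i]) : bool :=
  eigenvalue (map_mx (real_complex R) M) lambda.

(* Main.v *)
(** In one dimension write G = tau(G) + H, with H the Hankel part. The required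
    bounds amount to 2G - tau(G) = G + H and 3 tau(G) - 2G = G - 3H being positive
    definite. Off the diagonal, G <= H <= 0 entrywise because the symbol t_k is
    negative and increasing for k >= 1, so both matrices have off-diagonal
    absolute values at most - G - H; in each row every t_k with 1 <= k < n is
    used at most twice by the off-diagonal part of G together with H, and
    t_0 + 2 (t_1 + ... + t_(n-1)) > 0. Hence both are strictly diagonally
    dominant. Strict diagonal dominance is inherited by Kronecker sums, so
    A - P/2 and 3P/2 - A are positive definite, and an eigenvalue of P^-1 A is a
    generalized Rayleigh quotient of A and P. *)

Require Import Defs.
From mathcomp Require Import all_boot all_order all_algebra.
From mathcomp Require Import all_classical all_reals all_analysis.
From mathcomp Require Import mxtens complex ring lra zify.
Import Order.TTheory GRing.Theory Num.Theory.
Local Open Scope ring_scope.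

(** * Strict diagonal dominance and its stability under Kronecker sums *)

(* The diagonal entry is counted on both sides, which makes this form of strict
   diagonal dominance (with positive diagonal) multiplicative under tensmx. *)
Definition diag_dominant (R : numDomainType) (n : nat) (M : 'M[R]_n) : Prop :=
  forall i, \sum_j `|M i j| < 2 * M i i.

Arguments diag_dominant {R n} M.

Lemma diag_dominant_offdiag (R : numDomainType) (n : nat) (M : 'M[R]_n) :
  (forall i, \sum_(j | j != i) `|M i j| < M i i) -> diag_dominant M.
Proof.
move=> dM i; rewrite (bigD1 i) //= mulr2n mulrDl mul1r.
have M_ge0 : 0 <= M i i by apply: le_trans (ltW (dM i)); exact: sumr_ge0.
by rewrite ger0_norm // ltrD2l dM.
Qed.

Lemma diag_dominantD (R : numDomainType) (n : nat) (M N : 'M[R]_n) :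
  diag_dominant M -> diag_dominant N -> diag_dominant (M + N).
Proof.
move=> dM dN i; rewrite mxE mulrDr.
apply: le_lt_trans (ltrD (dM i) (dN i)); rewrite -big_split /=.
by apply: ler_sum => j _; rewrite mxE ler_normD.
Qed.

Lemma diag_dominantZ (R : numDomainType) (n : nat) (c : R) (M : 'M[R]_n) :
  0 < c -> diag_dominant M -> diag_dominant (c *: M).
Proof.
move=> c_gt0 dM i; rewrite mxE mulrCA.
under eq_bigr do rewrite mxE normrM (gtr0_norm c_gt0).
by rewrite -mulr_sumr ltr_pM2l.
Qed.

(** An empty sum is the zero matrix, which strictness excludes in positive dimension; hence
    [0 < m]. *)
Lemma diag_dominant_sum (R : numDomainType) (m n : nat) (M : 'I_m -> 'M[R]_n) :
  (0 < m)%N -> (forall k, diag_dominant (M k)) ->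
  diag_dominant (\sum_k M k).
Proof.
case: m M => // m M _ dM; elim: m M dM => [|m IHm] M dM.
  by rewrite big_ord_recl big_ord0 addr0.
by rewrite big_ord_recl; apply: diag_dominantD; [|apply: IHm => k].
Qed.

Lemma diag_dominant_cast (R : numDomainType) (n n' : nat) (e : n = n')
    (M : 'M[R]_n) :
  diag_dominant M -> diag_dominant (castmx (e, e) M).
Proof. by case: n' / e. Qed.

Lemma sum_norm_row_tensmx (R : numDomainType) (p q : nat) (A : 'M[R]_p)
    (B : 'M[R]_q) (i : 'I_p) (k : 'I_q) :
  \sum_j `|tensmx A B (mxtens_index (i, k)) j| =
  (\sum_j `|A i j|) * (\sum_l `|B k l|).
Proof.
rewrite mulr_sum; apply: eq_bigr => j _.
by rewrite mxE mxtens_indexK normrM.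
Qed.

Lemma sum_norm_row_scalar1 (R : numDomainType) (n : nat) (i : 'I_n) :
  \sum_j `|(1%:M : 'M[R]_n) i j| = 1.
Proof.
rewrite (bigD1 i) //= big1 => [|j /negbTE j_neq_i].
  by rewrite mxE eqxx normr1 addr0.
by rewrite mxE eq_sym j_neq_i normr0.
Qed.

Lemma diag_dominant_tens1mx (R : numDomainType) (p q : nat) (B : 'M[R]_q) :
  diag_dominant B -> diag_dominant (tensmx (1%:M : 'M[R]_p) B).
Proof.
move=> dB i; case: (mxtens_indexP i) => j k.
by rewrite sum_norm_row_tensmx tensmxE sum_norm_row_scalar1 mxE eqxx !mul1r.
Qed.

Lemma diag_dominant_tensmx1 (R : numDomainType) (p q : nat) (A : 'M[R]_p) :
  diag_dominant A -> diag_dominant (tensmx A (1%:M : 'M[R]_q)).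
Proof.
move=> dA i; case: (mxtens_indexP i) => j k.
by rewrite sum_norm_row_tensmx tensmxE sum_norm_row_scalar1 mxE eqxx !mulr1.
Qed.

Lemma diag_dominant_kron_sum (R : numDomainType) (m : nat) (n : 'I_m -> nat)
    (B : forall i, 'M[R]_(n i)) :
  (0 < m)%N -> (forall i, diag_dominant (B i)) ->
  diag_dominant (kron_sum B).
Proof.
move=> m_gt0 dB; apply: diag_dominant_sum => // i.
exact/diag_dominant_cast/diag_dominant_tensmx1/diag_dominant_tens1mx.
Qed.

Lemma trmx_kron_sum (R : comNzRingType) (m : nat) (n : 'I_m -> nat)
    (B : forall i, 'M[R]_(n i)) :
  (kron_sum B)^T = kron_sum (fun i => (B i)^T).
Proof.
rewrite /kron_sum linear_sum; apply: eq_bigr => i _ /=.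
by rewrite trmx_cast !trmx_tens !trmx1.
Qed.

Lemma kron_sum_linear (R : comNzRingType) (m : nat) (n : 'I_m -> nat)
    (c e : R) (B C : forall i, 'M[R]_(n i)) :
  c *: kron_sum B + e *: kron_sum C = kron_sum (fun i => c *: B i + e *: C i).
Proof.
rewrite /kron_sum !scaler_sumr -big_split; apply: eq_bigr => i _ /=.
apply/matrixP => j k; rewrite !(castmxE, mxE); ring.
Qed.

(** * Positive definite quadratic forms *)

Definition posdefmx (R : numDomainType) (n : nat) (M : 'M[R]_n) : Prop :=
  forall x : 'rV[R]_n, x != 0 -> 0 < (x *m M *m x^T) 0 0.

Arguments posdefmx {R n} M.

(* Summing M_ij x_i x_j + |M_ij| (x_i^2 + x_j^2) / 2 >= 0 over i <> j bounds the
   quadratic form from below by the sum of (2 M_ii - sum_j |M_ij|) x_i^2. *)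
Lemma diag_dominant_posdef (R : realFieldType) (n : nat) (M : 'M[R]_n) :
  M^T = M -> diag_dominant M -> posdefmx M.
Proof.
move=> symM dM x x_neq0.
have MC i j : M i j = M j i by rewrite -{1}symM mxE.
pose r i := 2 * M i i - \sum_j `|M i j|.
have r_gt0 i : 0 < r i by rewrite subr_gt0 dM.
have q_gt0 : 0 < \sum_i r i * x 0 i ^+ 2.
  have /rV0Pn[k xk_neq0] := x_neq0.
  rewrite (bigD1 k) //=; apply: ltr_wpDr.
    by apply: sumr_ge0 => i _; rewrite mulr_ge0 ?sqr_ge0 // ltW.
  by rewrite mulr_gt0 // exprn_even_gt0.
apply: lt_le_trans q_gt0 _.
have -> : (x *m M *m x^T) 0 0 = \sum_i \sum_j M i j * x 0 i * x 0 j.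
  rewrite mxE exchange_big; apply: eq_bigr => j _.
  rewrite !mxE mulr_suml; apply: eq_bigr => i _; ring.
have -> : \sum_i r i * x 0 i ^+ 2 =
    \sum_i 2 * M i i * x 0 i ^+ 2 -
    \sum_i \sum_j `|M i j| * (x 0 i ^+ 2 + x 0 j ^+ 2) / 2.
  (* Symmetry of [M] turns the [x_j^2] half into the [x_i^2] half. *)
  have -> : \sum_i \sum_j `|M i j| * (x 0 i ^+ 2 + x 0 j ^+ 2) / 2 =
      \sum_i \sum_j `|M i j| * x 0 i ^+ 2 / 2 +
      \sum_i \sum_j `|M i j| * x 0 i ^+ 2 / 2.
    rewrite [X in _ = _ + X]exchange_big -big_split /=; apply: eq_bigr => i _.
    rewrite -big_split; apply: eq_bigr => j _ /=; by rewrite (MC j i); field.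
  rewrite -[X in _ - X]big_split /= -sumrB; apply: eq_bigr => i _ /=.
  by rewrite -!mulr_suml /r; field.
rewrite lerBlDr -big_split /=; apply: ler_sum => i _ /=.
rewrite -big_split /= (bigD1 i) //= ler_wpDr //; last first.
  have := ler_norm (M i i); have := sqr_ge0 (x 0 i); nra.
apply: sumr_ge0 => j _.
(* The term is [|M i j| / 2] times the square of [x_i + x_j] or [x_i - x_j], according to the sign
   of [M i j]. *)
have := sqr_ge0 (x 0 i + x 0 j); have := sqr_ge0 (x 0 i - x 0 j).
by case: (ger0P (M i j)) => ? ? ?; nra.
Qed.


Lemma mulmx_form_sym (R : comNzRingType) (n : nat) (M : 'M[R]_n) (x y : 'rV[R]_n) :
  M^T = M -> (x *m M *m y^T) 0 0 = (y *m M *m x^T) 0 0.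
Proof.
move=> symM; have -> : x *m M *m y^T = (y *m M *m x^T)^T; last by rewrite mxE.
by rewrite !trmx_mul trmxK symM mulmxA.
Qed.

Lemma posdefmx_unit (R : realFieldType) (n : nat) (M : 'M[R]_n) :
  posdefmx M -> M \in unitmx.
Proof.
move=> pdM; rewrite -row_free_unit -kermx_eq0; apply/eqP/row_matrixP => i.
rewrite row0; apply/eqP/negPn/negP => /pdM.
by rewrite (sub_kermxP (row_sub i _)) mul0mx mxE ltxx.
Qed.

(** * Complex eigenvectors of real matrix pencils *)

Lemma Re_mulmx_real (R : rcfType) (n : nat) (w : 'rV[R[i]]_n) (A : 'M[R]_n) :
  map_mx (@complex.Re R) (w *m map_mx (real_complex R) A) = map_mx (@complex.Re R) w *m A.
Proof.
apply/rowP => j; rewrite !mxE raddf_sum; apply: eq_bigr => k _.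
by rewrite !mxE; case: (w 0 k) => x y /=; rewrite mulr0 subr0.
Qed.

Lemma Im_mulmx_real (R : rcfType) (n : nat) (w : 'rV[R[i]]_n) (A : 'M[R]_n) :
  map_mx (@complex.Im R) (w *m map_mx (real_complex R) A) = map_mx (@complex.Im R) w *m A.
Proof.
apply/rowP => j; rewrite !mxE raddf_sum; apply: eq_bigr => k _.
by rewrite !mxE; case: (w 0 k) => x y /=; rewrite mulr0 add0r.
Qed.

Lemma Re_scale_row (R : rcfType) (n : nat) (p q : R) (w : 'rV[R[i]]_n) :
  map_mx (@complex.Re R) ((p +i* q)%C *: w) =
  p *: map_mx (@complex.Re R) w - q *: map_mx (@complex.Im R) w.
Proof. by apply/rowP => j; rewrite !mxE; case: (w 0 j). Qed.

Lemma Im_scale_row (R : rcfType) (n : nat) (p q : R) (w : 'rV[R[i]]_n) :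
  map_mx (@complex.Im R) ((p +i* q)%C *: w) =
  p *: map_mx (@complex.Im R) w + q *: map_mx (@complex.Re R) w.
Proof. by apply/rowP => j; rewrite !mxE; case: (w 0 j). Qed.

Lemma Re_Im_row_eq0 (R : rcfType) (n : nat) (w : 'rV[R[i]]_n) :
  map_mx (@complex.Re R) w = 0 -> map_mx (@complex.Im R) w = 0 -> w = 0.
Proof.
move=> /rowP Re0 /rowP Im0; apply/rowP => j.
by have := Re0 j; have := Im0 j; rewrite !mxE; case: (w 0 j) => ? ? /= -> ->.
Qed.

(* Pairing the real and imaginary parts x, y of w A = lambda w P with y and x
   and using the symmetry of A and P gives
   Im lambda * (x P x^T + y P y^T) = 0. *)
Lemma pencil_spectrum (R : realType) (n : nat) (A P : 'M[R]_n) (l u : R)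
    (lambda : R[i]) :
  A^T = A -> P^T = P -> posdefmx P ->
  posdefmx (A - l *: P) -> posdefmx (u *: P - A) ->
  in_spectrum (invmx P *m A) lambda ->
  exists x : R, lambda = real_complex R x /\ l < x < u.
Proof.
move=> symA symP pdP pdl pdu /eigenvalueP[v v_eig v_neq0].
have P_unit := posdefmx_unit _ _ _ pdP.
(* For the row eigenvector [v], the substitution [v = w P] gives the generalized equation
   [w A = lambda w P]. *)
pose w := v *m map_mx (real_complex R) (invmx P).
have vE : v = w *m map_mx (real_complex R) P.
  by rewrite -mulmxA -map_mxM mulVmx // map_mx1 mulmx1.
have w_eig : w *m map_mx (real_complex R) A =
    lambda *: (w *m map_mx (real_complex R) P).
  by rewrite -vE -v_eig map_mxM mulmxA.
pose x := map_mx (@complex.Re R) w; pose y := map_mx (@complex.Im R) w.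
have xyP : x != 0 \/ y != 0.
  apply/orP; rewrite -negb_and; apply: contra v_neq0 => /andP[/eqP x0 /eqP y0].
  by rewrite vE (Re_Im_row_eq0 _ _ w) ?mul0mx.
case: lambda w_eig {v_eig} => p q w_eig.
have xA : x *m A = p *: (x *m P) - q *: (y *m P).
  by rewrite -Re_mulmx_real w_eig Re_scale_row Re_mulmx_real Im_mulmx_real.
have yA : y *m A = p *: (y *m P) + q *: (x *m P).
  by rewrite -Im_mulmx_real w_eig Im_scale_row Re_mulmx_real Im_mulmx_real.
have q0 : q = 0.
  pose f (z1 z2 : 'rV_n) := (z1 *m P *m z2^T) 0 0.
  have xAy : (x *m A *m y^T) 0 0 = p * f x y - q * f y y.
    by rewrite xA mulmxBl -!scalemxAl !mxE /f !mxE.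
  have yAx : (y *m A *m x^T) 0 0 = p * f y x + q * f x x.
    by rewrite yA mulmxDl -!scalemxAl !mxE /f !mxE.
  have fC : f x y = f y x by exact: mulmx_form_sym.
  have f_ge0 z : 0 <= f z z.
    have [->|z_neq0] := eqVneq z 0; first by rewrite /f !mul0mx mxE.
    by apply: ltW; apply: pdP.
  have f_gt0 : 0 < f x x + f y y.
    by case: xyP => /pdP ?; [exact: ltr_pwDl | exact: ltr_wpDl].
  have E : q * (f x x + f y y) = 0.
    have := mulmx_form_sym R n A x y symA; rewrite xAy yAx fC => /eqP.
    by rewrite -subr_eq0 => /eqP E; rewrite -[RHS]oppr0 -E; ring.
  by move/eqP: E; rewrite mulf_eq0 (gt_eqF f_gt0) orbF => /eqP.
(* On such a [z], the two positive forms are [p - l] and [u - p] times [z P z^T > 0]. *)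
have eig (z : 'rV_n) : z != 0 -> z *m A = p *: (z *m P) -> l < p < u.
  move=> z_neq0 zA; have fz_gt0 := pdP z z_neq0.
  have := pdl z z_neq0; have := pdu z z_neq0.
  rewrite !mulmxBr -!scalemxAr zA -!scalerBl -!scalemxAl.
  have ZE c : (c *: (z *m P *m z^T)) 0 0 = c * (z *m P *m z^T) 0 0.
    by rewrite mxE.
  by rewrite !ZE !pmulr_lgt0 // !subr_gt0 => -> ->.
exists p; split; first by rewrite q0.
move: xA yA; rewrite q0 !scale0r subr0 addr0 => xA yA.
by case: xyP => [x_neq0|y_neq0]; [apply: eig xA | apply: eig yA].
Qed.

(** * Signs, monotonicity and sums of the Grünwald coefficients *)

(** The [g_k] are the coefficients of [(1 - z)^alpha], and their partial sums those of
    [(1 - z)^(alpha - 1)]; differentiating the former relates the two. *)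
Lemma gl_coef_sum (R : numFieldType) (alpha : R) (k : nat) :
  gl_coef alpha k.+1 = - alpha / k.+1%:R * \sum_(j < k.+1) gl_coef alpha j.
Proof.
elim: k => [|k IHk]; first by rewrite big_ord1 /=; field.
rewrite big_ord_recr -[gl_coef alpha k.+2]/(_ * gl_coef alpha k.+1) /=.
rewrite -/(gl_coef alpha k.+1) mulrDr.
move: IHk; set S := \sum_(j < _) _ => ->.
by field; rewrite nat1r -natrD !pnatr_eq0.
Qed.

(** [g_2 = alpha (alpha - 1) / 2 > 0], and from [k = 3] on the factor [1 - (alpha + 1) / k] is
    positive. *)
Lemma gl_coef_gt0 (R : realFieldType) (alpha : R) (k : nat) :
  1 < alpha < 2 -> 0 < gl_coef alpha k.+2.
Proof.
move=> /andP[alpha_gt1 alpha_lt2]; elim: k => [|k IHk].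
  rewrite /=; have -> : (1 - (alpha + 1) / 2) * ((1 - (alpha + 1) / 1) * 1) =
    alpha * (alpha - 1) / 2 by field.
  by rewrite !mulr_gt0 ?subr_gt0 //; lra.
rewrite -[gl_coef alpha k.+3]/(_ * gl_coef alpha k.+2) mulr_gt0 // subr_gt0.
rewrite ltr_pdivrMr ?ltr0Sn // mul1r -[k.+3]/(3 + k)%N natrD.
have := ler0n R k; lra.
Qed.

Lemma gl_coef_nonincreasing (R : realFieldType) (alpha : R) (k : nat) :
  1 < alpha < 2 -> gl_coef alpha k.+3 <= gl_coef alpha k.+2.
Proof.
move=> alpha_bnd; rewrite -[gl_coef alpha k.+3]/(_ * gl_coef alpha k.+2).
rewrite ger_pMl ?gl_coef_gt0 // gerBl divr_ge0 //.
by case/andP: alpha_bnd => *; lra.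
Qed.

Lemma gl_symbol_le0 (R : realFieldType) (alpha : R) (k : nat) :
  1 < alpha < 2 -> gl_symbol alpha k.+1 <= 0.
Proof.
move=> alpha_bnd; case: k => [|k]; rewrite oppr_le0; last first.
  exact/ltW/gl_coef_gt0.
exact/ltW/addr_gt0/gl_coef_gt0.
Qed.

Lemma gl_symbol_nondecreasing (R : realFieldType) (alpha : R) (j k : nat) :
  1 < alpha < 2 -> (0 < j <= k)%N -> gl_symbol alpha j <= gl_symbol alpha k.
Proof.
move=> alpha_bnd /andP[j_gt0 /subnKC <-]; elim: (k - j)%N => [|l IHl].
  by rewrite addn0.
apply: le_trans IHl _; rewrite addnS; case: j j_gt0 => // j _; rewrite addSn.
case: (j + l)%N => [|i]; rewrite lerN2; last exact: gl_coef_nonincreasing.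
(* The exceptional step [t_1 <= t_2]: [g_3 <= g_2 <= g_0 + g_2]. *)
by apply: le_trans (gl_coef_nonincreasing _ _ 0 alpha_bnd) _; rewrite lerDr.
Qed.

(* sum_(j <= n) g_j = - (n + 1) g_(n + 1) / alpha is negative for n >= 1. *)
Lemma gl_symbol_sum_gt0 (R : realFieldType) (alpha : R) (n : nat) :
  1 < alpha < 2 ->
  0 < gl_symbol alpha 0 + 2 * \sum_(1 <= k < n) gl_symbol alpha k.
Proof.
move=> alpha_bnd; have [alpha_gt1 alpha_lt2] := andP alpha_bnd.
case: n => [|n]; first by rewrite big_geq //= mulr0 addr0; lra.
case: n => [|n]; first by rewrite big_geq //= mulr0 addr0; lra.
(* The term [g_1] absent from the symbol sum is supplied by [t_0 = - 2 g_1], so the whole expression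
   is [-2] times a partial sum of the [g_j]. *)
have -> : \sum_(1 <= k < n.+2) gl_symbol alpha k =
    - \sum_(j < n.+3) gl_coef alpha j + gl_coef alpha 1.
  elim: n => [|n IHn]; first by rewrite big_nat1 !big_ord_recr big_ord0 /=; ring.
  rewrite big_nat_recr //= IHn [in RHS]big_ord_recr /=; ring.
have := gl_coef_gt0 _ _ n.+1 alpha_bnd.
rewrite gl_coef_sum mulNr mulNr -mulrA oppr_gt0 pmulr_rlt0; last by lra.
rewrite pmulr_rlt0 ?invr_gt0 ?ltr0Sn //= => sum_lt0; lra.
Qed.

(** * Row sums of Toeplitz and Hankel matrices *)

(* The first terms are s_1, ..., s_i, the second ones s_(i+2), ..., s_(n-1). *)
Lemma antidiag_row_sum (R : numDomainType) (n i : nat) (s : nat -> R) :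
  (forall k, 0 <= s k.+1) -> (i < n)%N ->
  \sum_(j < n) ((if (j < i)%N then s (i - j)%N else 0) +
                (if (i + j + 2 < n)%N then s (i + j + 2)%N else 0)) <=
  \sum_(1 <= k < n) s k.
Proof.
move=> s_ge0 lt_in; rewrite big_split /=.
rewrite (@big_cat_nat _ _ _ i.+1) //=; apply: lerD.
  rewrite -big_mkcond /= -(big_mkord (fun j => (j < i)%N) (fun j => s (i - j)%N)).
  rewrite -(big_nat_widen 0 i n predT) ?(ltnW lt_in) //.
  rewrite big_nat_rev big_add1 /= le_eqVlt; apply/orP; left; apply/eqP.
  apply: eq_big_nat => j /andP[_ lt_ji]; congr s; lia.
have [le_ni|lt_i1n] := leqP n i.+1.
  rewrite [leRHS]big_geq // big1 // => j _.
  by case: ifP => //; lia.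
(* The term [s_(i+1)] does not occur on the left and is dropped. *)
rewrite [leRHS]big_ltn // ler_wpDl // -[i.+2]add0n big_addn -big_mkcond /=.
rewrite -(big_mkord (fun j => i + j + 2 < n)%N (fun j => s (i + j + 2)%N)).
rewrite (big_nat_widen 0 (n - i.+2) n predT) ?leq_subr //.
rewrite le_eqVlt; apply/orP; left; apply/eqP.
by apply: eq_big => [j|j _]; [rewrite /=; lia | congr s; lia].
Qed.

Lemma toeplitz_hankel_row_sum (R : numDomainType) (n : nat) (t : nat -> R) (i : 'I_n) :
  (forall k, t k.+1 <= 0) ->
  \sum_(j | j != i) - toeplitz n t i j + \sum_j - hankel_part n t i j <=
  - (2 * \sum_(1 <= k < n) t k).
Proof.
move=> t_le0; pose s k := - t k.
have s_ge0 k : 0 <= s k.+1 by rewrite oppr_ge0.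
(* Half a row, 0-based: the Toeplitz entry left of the diagonal and the upper left Hankel entry. *)
pose F (p q : nat) := (if (q < p)%N then s (p - q)%N else 0) +
                (if (p + q + 2 < n)%N then s (p + q + 2)%N else 0).
have -> : \sum_(j | j != i) - toeplitz n t i j + \sum_j - hankel_part n t i j =
    \sum_(j < n) F i j + \sum_(j < n) F (rev_ord i) j.
  (* Reflection in the center turns the entries right of the diagonal and the
     lower right Hankel corner into those left of it and the upper left one. *)
  rewrite [X in _ = _ + X](reindex_inj rev_ord_inj) big_mkcond -!big_split /=.
  apply: eq_bigr => j _; rewrite !mxE /F.
  rewrite -(inj_eq val_inj) /=.
  have := ltn_ord i; have := ltn_ord j; move: (val i) (val j) => p q q_n p_n.
  have -> : (n - p.+1 - (n - q.+1))%N = (q - p)%N by lia.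
  have -> : (n - q.+1 < n - p.+1)%N = (p < q)%N by lia.
  have -> : (n - p.+1 + (n - q.+1) + 2)%N = (2 * n + 2 - (p.+1 + q.+1))%N by lia.
  have -> : (p.+1 + q.+1)%N = (p + q + 2)%N by lia.
  have [lt_qp|lt_pq|->] := ltngtP q p.
  - have -> : `|p - q|%N = (p - q)%N by lia.
    by rewrite /s /=; do !case: ifP => ?; first [ring | exfalso; lia].
  - have -> : `|p - q|%N = (q - p)%N by lia.
    by rewrite /s /=; do !case: ifP => ?; first [ring | exfalso; lia].
  by rewrite /s /=; do !case: ifP => ?; first [ring | exfalso; lia].
have -> : - (2 * \sum_(1 <= k < n) t k) =
    \sum_(1 <= k < n) s k + \sum_(1 <= k < n) s k.
  by rewrite mulr2n mulrDl mul1r opprD !sumrN.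
by apply: lerD; apply: antidiag_row_sum.
Qed.

Lemma hankel_part_le0 (R : numDomainType) (n : nat) (t : nat -> R) (i j : 'I_n) :
  (forall k, t k.+1 <= 0) -> hankel_part n t i j <= 0.
Proof.
move=> t_le0; rewrite mxE /=.
have := ltn_ord i; have := ltn_ord j; move: (val i) (val j) => p q q_n p_n.
have t_le0' k : (0 < k)%N -> t k <= 0 by case: k.
by case: ifP => _; [apply: t_le0'|case: ifP => // _; apply: t_le0']; lia.
Qed.

(** Where the Hankel entry is some [t_k], its index is at least [|i - j| > 0]. *)
Lemma toeplitz_le_hankel_part (R : numDomainType) (n : nat) (t : nat -> R)
    (i j : 'I_n) :
  (forall k, t k.+1 <= 0) -> (forall k l, (0 < k <= l)%N -> t k <= t l) ->
  j != i -> toeplitz n t i j <= hankel_part n t i j.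
Proof.
move=> t_le0 t_nd; rewrite -(inj_eq val_inj) !mxE /=.
have := ltn_ord i; have := ltn_ord j; move: (val i) (val j) => p q q_n p_n q_neq_p.
have t_le0' k : (0 < k)%N -> t k <= 0 by case: k.
case: ifP => _; first by apply: t_nd; lia.
by case: ifP => _; [apply: t_le0' | apply: t_nd]; lia.
Qed.

(* Off the diagonal T <= H <= 0, hence |T + c H| <= - (T + H) for -3 <= c <= 1. *)
Lemma diag_dominant_toeplitz_hankel (R : realDomainType) (n : nat)
    (t : nat -> R) (c : R) :
  (forall k, t k.+1 <= 0) ->
  (forall k l, (0 < k <= l)%N -> t k <= t l) ->
  0 < t 0%N + 2 * \sum_(1 <= k < n) t k ->
  -3 <= c <= 1 -> diag_dominant (toeplitz n t + c *: hankel_part n t).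
Proof.
move=> t_le0 t_nd t_sum /andP[c_ge c_le].
set G := toeplitz n t; set H := hankel_part n t.
have leH i j : H i j <= 0 by exact: hankel_part_le0.
have leGH i j : j != i -> G i j <= H i j by exact: toeplitz_le_hankel_part.
have Gii i : G i i = t 0%N by rewrite mxE subrr.
have row_lt i : \sum_(j | j != i) (- G i j - H i j) < t 0%N + H i i.
  have := toeplitz_hankel_row_sum _ _ _ i t_le0.
  rewrite big_split /= -/G -/H [X in _ + X <= _](bigD1 i) //=; lra.
have GHE i j : (G + c *: H) i j = G i j + c * H i j by rewrite !mxE.
apply: diag_dominant_offdiag => i; rewrite GHE Gii.
apply: (@lt_le_trans _ _ (t 0%N + H i i)); last first.
  by have := leH i i; nra.
apply: le_lt_trans (row_lt i).
(* The lower bound reads [(1 - c) H <= 0]; the upper one, [2 G + (c + 1) H <= 0], follows from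
   [G <= H] and [(c + 3) H <= 0]. *)
apply: ler_sum => j j_neq_i; rewrite GHE ler_norml.
by have := leH i j; have := leGH i j j_neq_i => ? ?; apply/andP; split; nra.
Qed.

(** * The [tau] matrix and the positive weights *)

Lemma first_col_scale_toeplitz (R : nzRingType) (n k : nat) (w : R) (t : nat -> R) :
  (k < n)%N -> first_col (w *: toeplitz n t) k = w * t k.
Proof.
move=> lt_kn; have n_gt0 : (0 < n)%N by lia.
by rewrite /first_col !insubT !mxE /= addn0.
Qed.

Lemma tau_scale_toeplitz (R : nzRingType) (n : nat) (w : R) (t : nat -> R) :
  tau (w *: toeplitz n t) = w *: (toeplitz n t - hankel_part n t).
Proof.
rewrite scalerBr; congr (_ - _); apply/matrixP => i j; rewrite !mxE /=.
have := ltn_ord i; have := ltn_ord j; move: (val i) (val j) => p q q_n p_n.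
case: ifP => [?|_]; first by rewrite first_col_scale_toeplitz.
case: ifP => [?|?]; first by rewrite mulr0.
(* Here the index sum is at least [n + 3], so the reflected index is below [n]. *)
by rewrite first_col_scale_toeplitz //; lia.
Qed.

Lemma trmx_toeplitz (R : Type) (n : nat) (t : nat -> R) :
  (toeplitz n t)^T = toeplitz n t.
Proof. by apply/matrixP => i j; rewrite !mxE distnC. Qed.

Lemma trmx_hankel_part (R : nzRingType) (n : nat) (t : nat -> R) :
  (hankel_part n t)^T = hankel_part n t.
Proof. by apply/matrixP => i j; rewrite !mxE addnC. Qed.

Lemma riesz_weight_gt0 (R : realType) (n : nat) (alpha d a b : R) :
  1 < alpha < 2 -> 0 < d -> a < b -> 0 < riesz_weight n alpha d a b.
Proof.
move=> /andP[alpha_gt1 alpha_lt2] d_gt0 lt_ab; have pi_gt0 := pi_gt0 R.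
(* The angle lies strictly between [pi / 2] and [pi]. *)
have cos_lt0 : cos (alpha * pi / 2) < 0.
  rewrite -[alpha * pi / 2](subrK (pi / 2)) cosDpihalf oppr_lt0 sin_gt0_pi //.
  by apply/andP; split; nra.
have const_gt0 : 0 < riesz_const alpha.
  by rewrite /riesz_const mulN1r oppr_gt0 invr_lt0 pmulr_rlt0.
have mesh_gt0 : 0 < mesh_size n a b by rewrite divr_gt0 ?subr_gt0.
by rewrite divr_gt0 ?powR_gt0 // mulr_gt0.
Qed.

Theorem theorem4p7 (R : realType) (m : nat) (n : 'I_m -> nat)
    (alpha d a b : 'I_m -> R)
    (m_gt0 : (0 < m)%N)
    (n_gt0 : forall i, (0 < n i)%N)
    (alpha_bnd : forall i, 1 < alpha i < 2)
    (d_gt0 : forall i, 0 < d i)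
    (ltab : forall i, a i < b i) :
  precond_mx n alpha d a b \in unitmx /\
  (forall lambda : R[i],
     in_spectrum (invmx (precond_mx n alpha d a b) *m coef_mx n alpha d a b)
       lambda ->
     exists x : R, lambda = real_complex R x /\ 1 / 2 < x < 3 / 2).
Proof.
set A := coef_mx n alpha d a b; set P := precond_mx n alpha d a b.
pose w i := riesz_weight (n i) (alpha i) (d i) (a i) (b i).
have w_gt0 i : 0 < w i by apply: riesz_weight_gt0.
pose G i := gl_mx (n i) (alpha i).
pose H i := hankel_part (n i) (gl_symbol (alpha i)).
have AE : A = kron_sum (fun i => w i *: G i) by [].
have PE : P = kron_sum (fun i => w i *: (G i - H i)).
  congr kron_sum; apply: functional_extensionality_dep => i.
  exact: tau_scale_toeplitz.
have symGH c i : (G i + c *: H i)^T = G i + c *: H i.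
  by rewrite linearD linearZ /= trmx_toeplitz trmx_hankel_part.
(* Used with [c = 0] for [A], [-1] for [P], and the extreme values [1] and [-3] for the two spectral
   bounds. *)
have pd c (B : forall i, 'M[R]_(n i)) : -3 <= c <= 1 ->
    (forall i, exists2 v, 0 < v & B i = v *: (G i + c *: H i)) ->
    (kron_sum B)^T = kron_sum B /\ posdefmx (kron_sum B).
  move=> c_bnd BE.
  have symB : (kron_sum B)^T = kron_sum B.
    rewrite trmx_kron_sum; congr kron_sum.
    apply: functional_extensionality_dep => i; have [v _ ->] := BE i.
    by rewrite linearZ /= symGH.
  split=> //; apply: diag_dominant_posdef symB _.
  apply: diag_dominant_kron_sum => // i; have [v v_gt0 ->] := BE i.
  apply/diag_dominantZ => //; apply: diag_dominant_toeplitz_hankel => //.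
  - by move=> k; apply: gl_symbol_le0.
  - by move=> k l; apply: gl_symbol_nondecreasing.
  exact: gl_symbol_sum_gt0.
have [symA _] : A^T = A /\ posdefmx A.
  apply: (pd 0) => [|i]; first by lra.
  by exists (w i); rewrite // scale0r addr0.
have [symP pdP] : P^T = P /\ posdefmx P.
  rewrite PE; apply: (pd (-1)) => [|i]; first by lra.
  by exists (w i); rewrite // scaleN1r.
split; first exact: posdefmx_unit.
move=> lambda; apply: pencil_spectrum => //.
  rewrite -[A]scale1r -scaleNr AE PE kron_sum_linear.
  apply: (proj2 (pd 1 _ _ _)) => [|i]; first by lra.
  (* [w G - w (G - H) / 2 = (w / 2) (G + H)]. *)
  exists (w i / 2); first by rewrite divr_gt0.
  by apply/matrixP => j k; rewrite !mxE; field.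
rewrite -scaleN1r AE PE kron_sum_linear.
apply: (proj2 (pd (-3) _ _ _)) => [|i]; first by lra.
(* [3 w (G - H) / 2 - w G = (w / 2) (G - 3 H)]. *)
exists (w i / 2); first by rewrite divr_gt0.
by apply/matrixP => j k; rewrite !mxE; field.
Qed.
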